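(* Let $f\in\mathbb{R}[\mathbf{x}]$, $\mathbf{x}=(x_1,\dots,x_n)$, with $\deg(f)=d$. Suppose that $f$ admits a correlative sparsity pattern $(\mathbf{x}(1),\dots,\mathbf{x}(p))$ satisfying the running intersection property. (1) If $f\ge0$ on $\mathbb{R}^n$, then for any $\epsilon>0$ there exist $\sigma_\ell\in\Sigma[\tilde{\mathbf{x}}(\ell)\cup\{w_\ell\}]$ and $\tau_\ell\in\mathbb{R}[\tilde{\mathbf{x}}(\ell)\cup\{w_\ell\}]$, $\ell=1,\dots,p$, such that $$\tilde f+\epsilon\left(\sum_{i=0}^n x_i^d+\sum_{\ell=1}^p w_\ell^d\right)=\sum_{\ell=1}^p\left(\sigma_\ell+\tau_\ell\left(\|\tilde{\mathbf{x}}(\ell)\|^2+w_\ell^2-1\right)\right).$$ (2) If $f>0$ on $\mathbb{R}^n$ and the form $f^{(\infty)}$ is positive definite, then for any $\epsilon>0$ there exist $\sigma_\ell\in\Sigma[\tilde{\mathbf{x}}(\ell)\cup\{w_\ell\}]$ and $\tau_\ell\in\mathbb{R}[\tilde{\mathbf{x}}(\ell)\cup\{w_\ell\}]$, $\ell=1,\dots,p$, such that $$\tilde f+\epsilon\sum_{\ell=1}^p w_\ell^d=\sum_{\ell=1}^p\left(\sigma_\ell+\tau_\ell\left(\|\tilde{\mathbf{x}}(\ell)\|^2+w_\ell^2-1\right)\right).$$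
   Context: Let $x_0$ be a homogenization variable, $\tilde{\mathbf{x}}=(x_0,x_1,\dots,x_n)$, $\tilde f(\tilde{\mathbf{x}})=x_0^{d}f(\mathbf{x}/x_0)$ the homogenization of $f$, and $f^{(\infty)}$ the homogeneous part of $f$ of degree $d$. A form is positive definite if it is $>0$ at every nonzero point. The variables $w_1,\dots,w_p$ are auxiliary, one per clique, and $\tilde{\mathbf{x}}(\ell)=(x_0,\mathbf{x}(\ell))$, so $\|\tilde{\mathbf{x}}(\ell)\|^2=x_0^2+\sum_{x_i\in\mathbf{x}(\ell)}x_i^2$. For a set of variables $V$, $\Sigma[V]$ denotes the set of sums of squares of polynomials in $\mathbb{R}[V]$. Identities are polynomial identities in $\mathbb{R}[x_0,\dots,x_n,w_1,\dots,w_p]$. A polynomial $f$ admits the correlative sparsity pattern $(\mathbf{x}(1),\dots,\mathbf{x}(p))$, where $\mathbf{x}(\ell)\subseteq\{x_1,\dots,x_n\}$ and $\bigcup_\ell\mathbf{x}(\ell)=\{x_1,\dots,x_n\}$, if $f=\sum_{\ell=1}^pf_\ell$ with $f_\ell\in\mathbb{R}[\mathbf{x}(\ell)]$. The pattern satisfies the running intersection property if for every $\ell\in\{1,\dots,p-1\}$ there is $s\in\{1,\dots,\ell\}$ with $\mathbf{x}(\ell+1)\cap\bigcup_{j=1}^{\ell}\mathbf{x}(j)\subseteq\mathbf{x}(s)$. *)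

(* Defs.v *)
From mathcomp Require Import all_boot all_order all_algebra.
From mathcomp Require Import ring.
From mathcomp Require Import reals.
From mathcomp Require Import mpoly.

Set Implicit Arguments.
Unset Strict Implicit.
Unset Printing Implicit Defensive.

Import Order.TTheory GRing.Theory Num.Theory.

Local Open Scope ring_scope.

Section SubsetsOfVariables.

Variables (R : realType) (N : nat).
Implicit Types (V : {set 'I_N}) (q g : {mpoly R[N]}).

(* q lies in R[V] *)
Definition in_vars V q : Prop :=
  forall m, m \in msupp q -> forall i : 'I_N, m i != 0%N -> i \in V.

(* q lies in Sigma[V] *)
Definition sos_in_vars V q : Prop :=
  exists s : seq {mpoly R[N]},
    (forall r, r \in s -> in_vars V r) /\ q = \sum_(r <- s) r ^+ 2.

Definition positive_definite g : Prop :=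
  forall v : 'I_N -> R, (exists i, v i != 0) -> 0 < g.@[v].

End SubsetsOfVariables.

Section CorrelativeSparsity.

Variables (R : realType) (n p : nat).
Implicit Types (f : {mpoly R[n]}) (c : 'I_p -> {set 'I_n}).

Definition admits_csp f c : Prop :=
  \bigcup_l c l = [set: 'I_n] /\
  exists g : 'I_p -> {mpoly R[n]},
    (forall l, in_vars (c l) (g l)) /\ f = \sum_l g l.

(* Cliques are indexed from 0, so k stands for l + 1. *)
Definition running_intersection c : Prop :=
  forall k : 'I_p, (0 < k)%N ->
    exists s : 'I_p, (s < k)%N /\
      c k :&: \bigcup_(j < p | (j < k)%N) c j \subset c s.

(* Indices of x_0, .., x_n and of w_1, .., w_p in R[x_0, .., x_n, w_1, .., w_p];
   in particular x_0 has index ix ord0, and the variable of index i of R[x] has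
   index ix (lift ord0 i). *)
Definition ix (i : 'I_n.+1) : 'I_(n.+1 + p) := lshift p i.
Definition iw (l : 'I_p) : 'I_(n.+1 + p) := rshift n.+1 l.

(* x_0^d f(x / x_0), expanded monomial by monomial; meaningful when
   deg f <= d, see homogenizationE. *)
Definition homogenization (d : nat) f : {mpoly R[n.+1 + p]} :=
  \sum_(m <- msupp f)
     f@_m *: ('X_(ix ord0) ^+ (d - mdeg m)
              * \prod_(i < n) 'X_(ix (lift ord0 i)) ^+ (m i)).

Lemma homogenizationE d f (v : 'I_(n.+1 + p) -> R) :
  (msize f <= d.+1)%N -> v (ix ord0) != 0 ->
  (homogenization d f).@[v] =
    v (ix ord0) ^+ d * f.@[fun i => v (ix (lift ord0 i)) / v (ix ord0)].
Proof.
move=> sz_f v0; rewrite /homogenization raddf_sum mevalE mulr_sumr /=.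
rewrite !big_seq; apply: eq_bigr => m m_f.
have le_md : (mdeg m <= d)%N.
  by rewrite -ltnS; apply: leq_trans (msize_mdeg_lt m_f) sz_f.
rewrite mevalZ mevalM rmorphXn /= mevalXU rmorph_prod /= mulrCA.
under eq_bigr => i _ do rewrite rmorphXn /= mevalXU.
under [in RHS]eq_bigr => i _ do rewrite expr_div_n.
rewrite prodf_div -expr_sum -mdegE -{2}(subnK le_md) exprD.
by field; rewrite expf_neq0.
Qed.

(* The variables of x~(l) together with w_l. *)
Definition clique_vars c (l : 'I_p) : {set 'I_(n.+1 + p)} :=
  [set ix ord0; iw l] :|: [set ix (lift ord0 i) | i in c l].

(* |x~(l)|^2 + w_l^2 - 1 *)
Definition clique_sphere c (l : 'I_p) : {mpoly R[n.+1 + p]} :=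
  'X_(ix ord0) ^+ 2 + \sum_(i in c l) 'X_(ix (lift ord0 i)) ^+ 2
  + 'X_(iw l) ^+ 2 - 1.

End CorrelativeSparsity.

Arguments ix {n} p i.
Arguments iw n {p} l.
Arguments homogenization {R n} p d f.
Arguments clique_sphere R {n p} c l.

(* Main.v *)
Require Import Defs.
From mathcomp Require Import all_boot all_order all_algebra.
From mathcomp Require Import ring lra.
From mathcomp Require Import reals mpoly.
From mathcomp Require interval_inference boolp classical_sets topology.
From mathcomp Require normedtype sequences.

(** On the intersection of the spheres [|x~(l)|^2 + w_l^2 = 1] the left-hand side
    of either identity is positive. The degree of a nonnegative polynomial is even
    ([nonneg_even_degree]), so that the homogenization is nonnegative everywhere
    ([homogenization_ge0]) and the perturbation is nonnegative. In part (1) the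
    perturbation is positive because some coordinate on the sphere is nonzero. In
    part (2) the homogenization itself is positive unless [x_0] and all the [x_i]
    vanish, where [w_l^2 = 1]. The theorem is then an instance of a sparse
    Positivstellensatz for spheres ([sparse_sphere_positivstellensatz]), because
    the left-hand side is a sum of polynomials in the variables of the cliques and
    the extended cliques inherit the running intersection property
    ([clique_vars_rip]).

    That Positivstellensatz is proved through Bernstein polynomials.

    By compactness, the sum [F] of the [F_l] stays positive on the whole cube
    [[-1, 1]^M] after a large multiple of the squared sphere polynomials is added
    to the [F_l] ([box_penalty]); this modifies the [F_l] in the ideals of the
    spheres only, and makes the cube the only set to consider.

    The polynomials [(1 + X_i) / 2] and [(1 - X_i) / 2] are sums of squares modulo
    the sphere of any clique containing [X_i] ([cone_halfDX]), and sums of squares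
    modulo one sphere are closed under products. Hence so are all nonnegative
    combinations of products of Bernstein polynomials in the variables of a clique
    ([cone_bernstein_comb]).

    In degree [N], the tensor Bernstein coefficients of [F_l] form a function on a
    finite grid, depending only on the coordinates in clique [l]
    ([depends_on_grid_coef]), and this function is close to the values of [F_l]
    when [N] is large ([grid_coef_close]). The sum over [l] is therefore
    nonnegative on the grid, although single coefficients may be negative. The
    running intersection property repairs this on the grid: a nonnegative sum of
    functions of the cliques is a sum of nonnegative functions of the cliques
    ([rip_splitting]). Since Bernstein polynomials in each variable sum to 1, a
    function on the grid that only depends on shared coordinates has the same
    polynomial in any clique containing them. Thus the new coefficients give
    polynomials with the same sum as the [F_l], each a sum of squares modulo the
    sphere of its clique. *)

Set Implicit Arguments.
Unset Strict Implicit.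
Unset Printing Implicit Defensive.

Import Order.TTheory GRing.Theory Num.Theory.

Local Open Scope ring_scope.

(** * Positivity near a compact zero set *)

Definition in_box (R : realType) (M : nat) (r : R) (v : 'I_M -> R) : Prop :=
  forall i, `|v i| <= r.

Definition box_lipschitz (R : realType) (M : nat) (r L : R)
    (F : ('I_M -> R) -> R) : Prop :=
  forall u v, in_box r u -> in_box r v ->
  forall e : R, (forall i, `|u i - v i| <= e) -> `|F u - F v| <= L * e.

Module Compactness.
Import boolp classical_sets topology normedtype sequences.
Import numFieldNormedType.Exports.
Import interval_inference.

Local Open Scope classical_set_scope.
Local Open Scope ring_scope.

(** On a compact box, positivity on the zero set of a nonnegative [S] becomes
    uniform positivity on the whole box once a large multiple of [S] is added:
    near a zero of [S] the function [F] is bounded below by a positive number,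
    and near any other point [C * S] exceeds all bounds. *)
Lemma box_penalty (R : realType) (M : nat) (r : R) (F S : ('I_M -> R) -> R) :
  (exists2 L : R, 0 <= L & box_lipschitz r L F) ->
  (exists2 L : R, 0 <= L & box_lipschitz r L S) ->
  (forall v, in_box r v -> 0 <= S v) ->
  (forall v, in_box r v -> S v = 0 -> 0 < F v) ->
  exists C delta : R, [/\ 0 <= C, 0 < delta &
    forall v, in_box r v -> delta <= F v + C * S v].
Proof.
move=> [LF LF0 lipF] [LS LS0 lipS] S_ge0 F_gt0.
pose box := [set x : 'rV[R]_M |
  forall i, (`[- r, r]%classic : set R) (x ord0 i)]%classic.
have boxP (x : 'rV[R]_M) : box x <-> in_box r (x ord0).
  by split=> bx i; have := bx i; rewrite /= in_itv /= ler_norml.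
have box_compact : compact box.
  apply: (@rV_compact R M (fun _ => `[- r, r]%classic)) => i.
  exact: segment_compact.
pose P (k : nat) (x : 'rV[R]_M) :=
  in_box r (x ord0) -> k.+1%:R^-1 <= F (x ord0) + k%:R * S (x ord0).
have near_lip (G : ('I_M -> R) -> R) (L e : R) (x : 'rV[R]_M) :
    0 <= L -> 0 < e -> box_lipschitz r L G -> in_box r (x ord0) ->
    \forall y \near x,
      in_box r ((y : 'rV[R]_M) ord0) -> `|G (x ord0) - G (y ord0)| <= e.
  move=> L0 e0 lipG bx; near=> y => by_.
  have h i : `|x ord0 i - y ord0 i| <= e / (L + 1).
    have : ball x (e / (L + 1)) y.
      by near: y; apply: nbhsx_ballx; rewrite divr_gt0 //; lra.
    by case=> _ /(_ ord0 i) /ltW.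
  apply: le_trans (lipG _ _ bx by_ _ h) _.
  by rewrite mulrA ler_pdivrMr; nra.
have arith0 (a b c e : R) :
  a - b <= a / 2 -> c < a / 2 -> 0 <= e -> c <= b + e.
  by lra.
have arith1 (a b c e e' : R) :
  a - b <= 1 -> e <= e' -> c <= 1 -> 2 - a <= e -> c <= b + e'.
  by lra.
have arith2 (a b : R) : a - b <= a / 2 -> a / 2 <= b by lra.
(* The property of k and x asks for the bound with C = k and delta = 1/(k+1);
   it holds for x near any given point and k large, hence by compactness for
   some k and all x in the box. *)
have cover : \forall k \near \oo, forall x, box x -> P k x.
  apply: ((compact_near_coveringP box).1 box_compact nat \oo P _) => x /boxP bx.
  have [S0|S0] := eqVneq (S (x ord0)) 0.
    have F0 := F_gt0 _ bx S0.
    have a0 : 0 < F (x ord0) / 2 by rewrite divr_gt0.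
    near=> y k.
    have dF : in_box r ((y : 'rV[R]_M) ord0) ->
        `|F (x ord0) - F (y ord0)| <= F (x ord0) / 2.
      by near: y; exact: near_lip LF0 a0 lipF bx.
    have ka : k.+1%:R^-1 < F (x ord0) / 2.
      near: k; exact: (near_infty_natSinv_lt (PosNum a0)).
    move=> by_; have S1 := S_ge0 _ by_.
    have kS : 0 <= k%:R * S (y ord0) by rewrite mulr_ge0.
    by move: (dF by_); rewrite ler_norml => /andP[_ /arith0]; apply.
  have {S0} S0 : 0 < S (x ord0) by rewrite lt_neqAle eq_sym S0 S_ge0.
  have a0 : 0 < S (x ord0) / 2 by rewrite divr_gt0.
  near=> y k.
  have dF : in_box r ((y : 'rV[R]_M) ord0) -> `|F (x ord0) - F (y ord0)| <= 1.
    by near: y; exact: near_lip LF0 ltr01 lipF bx.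
  have dS : in_box r ((y : 'rV[R]_M) ord0) ->
      `|S (x ord0) - S (y ord0)| <= S (x ord0) / 2.
    by near: y; exact: near_lip LS0 a0 lipS bx.
  have k1 : k.+1%:R^-1 <= 1 :> R by rewrite invf_le1 // ler1n.
  have kF : (2 - F (x ord0)) / (S (x ord0) / 2) <= k%:R.
    near: k; exact: nbhs_infty_ger.
  move: kF; rewrite ler_pdivrMr // => kF by_.
  have := dS by_; have := dF by_.
  rewrite !ler_norml => /andP[_ dF'] /andP[_ dS'].
  apply: arith1 dF' _ k1 kF; apply: ler_wpM2l => //.
  exact: arith2.
have [k _ /(_ k (leqnn k)) kP] := cover.
exists k%:R, k.+1%:R^-1; split=> // v bv.
pose x : 'rV[R]_M := \row_i v i.
have xv : x ord0 = v by apply: funext => i; rewrite mxE.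
by rewrite -xv; apply: kP; rewrite ?xv //; apply/boxP; rewrite xv.
Unshelve. all: by end_near.
Qed.
End Compactness.

(** * Sums of squares modulo a sphere *)

Section SphereCone.

Variables (R : realType) (M : nat).
Implicit Types (V : {set 'I_M}) (q g : {mpoly R[M]}).

Lemma in_vars0 V : in_vars V (0 : {mpoly R[M]}).
Proof. by move=> m; rewrite msupp0. Qed.

Lemma in_varsC V (a : R) : in_vars V (a%:MP_[M]).
Proof.
move=> m; rewrite mcoeff_msupp mcoeffC; have [->|] := eqVneq m 0%MM.
  by move=> _ i; rewrite mnm0E eqxx.
by rewrite mulr0 eqxx.
Qed.

Lemma in_vars1 V : in_vars V (1 : {mpoly R[M]}).
Proof. by rewrite -mpolyC1; exact: in_varsC. Qed.

Lemma in_varsX V i : i \in V -> in_vars V ('X_i : {mpoly R[M]}).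
Proof.
move=> iV m; rewrite msuppX inE => /eqP -> j; rewrite mnm1E.
by have [<-|] := eqVneq i j.
Qed.

Lemma in_varsD V q g : in_vars V q -> in_vars V g -> in_vars V (q + g).
Proof.
by move=> qV gV m /msuppD_le; rewrite mem_cat => /orP[/qV|/gV].
Qed.

Lemma in_varsZ V (a : R) q : in_vars V q -> in_vars V (a *: q).
Proof. by move=> qV m /msuppZ_le /qV. Qed.

Lemma in_varsN V q : in_vars V q -> in_vars V (- q).
Proof. by rewrite -scaleN1r; exact: in_varsZ. Qed.

Lemma in_varsM V q g : in_vars V q -> in_vars V g -> in_vars V (q * g).
Proof.
move=> qV gV m /msuppM_le /allpairsP[[m1 m2] /= [m1q m2g ->]] i.
rewrite mnmDE addn_eq0 negb_and => /orP[]; [exact: qV|exact: gV].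
Qed.

Lemma in_varsXn V q k : in_vars V q -> in_vars V (q ^+ k).
Proof.
move=> qV; elim: k => [|k IH]; first by rewrite expr0; exact: in_vars1.
by rewrite exprS; exact: in_varsM.
Qed.

Lemma in_vars_sum V (I : Type) (r : seq I) (P : pred I)
    (F : I -> {mpoly R[M]}) :
  (forall i, P i -> in_vars V (F i)) -> in_vars V (\sum_(i <- r | P i) F i).
Proof.
by move=> FV; elim/big_ind: _ => //; [exact: in_vars0|exact: in_varsD].
Qed.

Lemma in_vars_prod V (I : Type) (r : seq I) (P : pred I)
    (F : I -> {mpoly R[M]}) :
  (forall i, P i -> in_vars V (F i)) -> in_vars V (\prod_(i <- r | P i) F i).
Proof.
by move=> FV; elim/big_ind: _ => //; [exact: in_vars1|exact: in_varsM].
Qed.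

Lemma sosD V q g : sos_in_vars V q -> sos_in_vars V g -> sos_in_vars V (q + g).
Proof.
move=> [s [sV ->]] [t [tV ->]]; exists (s ++ t); split; last by rewrite big_cat.
by move=> r; rewrite mem_cat => /orP[/sV|/tV].
Qed.

Lemma sos_sqr V q : in_vars V q -> sos_in_vars V (q ^+ 2).
Proof.
by move=> qV; exists [:: q]; split=> [r|]; rewrite ?inE ?big_seq1 // => /eqP ->.
Qed.

Lemma sos0 V : sos_in_vars V (0 : {mpoly R[M]}).
Proof. by exists [::]; rewrite big_nil. Qed.

Lemma sosM V q g : sos_in_vars V q -> sos_in_vars V g -> sos_in_vars V (q * g).
Proof.
move=> [s [sV ->]] [t [tV ->]].
exists [seq x * y | x <- s, y <- t]; split.
  by move=> r /allpairsP[[x y] /= [xs yt ->]]; apply: in_varsM; auto.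
rewrite big_allpairs_dep mulr_suml; apply: eq_bigr => x _.
by rewrite mulr_sumr; apply: eq_bigr => y _; rewrite exprMn.
Qed.

Lemma sosZ V (a : R) q : 0 <= a -> sos_in_vars V q -> sos_in_vars V (a *: q).
Proof.
move=> a0 qV; rewrite -mul_mpolyC; apply: sosM qV.
rewrite -(sqr_sqrtr a0) rmorphXn; apply: sos_sqr; exact: in_varsC.
Qed.

Lemma sos_in_vars_in_vars V q : sos_in_vars V q -> in_vars V q.
Proof.
move=> [s [sV ->]]; rewrite big_seq.
by apply: in_vars_sum => r /sV; exact: in_varsXn.
Qed.

Definition sphere V : {mpoly R[M]} := \sum_(i in V) 'X_i ^+ 2 - 1.

(** The preorder generated by the sphere. With a single equality constraint, the
    quadratic module of Putinar's theorem is closed under products, which is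
    what lets products of nonnegative polynomials enter below. *)
Definition sphere_cone V q : Prop :=
  exists sigma tau, [/\ sos_in_vars V sigma, in_vars V tau &
    q = sigma + tau * sphere V].

Lemma in_vars_sphere V : in_vars V (sphere V).
Proof.
apply: in_varsD; last by apply: in_varsN; exact: in_vars1.
by apply: in_vars_sum => i iV; apply: in_varsXn; exact: in_varsX.
Qed.

Lemma coneD V q g : sphere_cone V q -> sphere_cone V g -> sphere_cone V (q + g).
Proof.
move=> [s [t [sV tV ->]]] [s' [t' [sV' tV' ->]]].
exists (s + s'), (t + t'); split; [exact: sosD|exact: in_varsD|].
by rewrite mulrDl addrACA.
Qed.

(** The cross terms are multiples of the sphere polynomial. *)
Lemma coneM V q g : sphere_cone V q -> sphere_cone V g -> sphere_cone V (q * g).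
Proof.
move=> [s [t [sV tV ->]]] [s' [t' [sV' tV' ->]]].
exists (s * s'), (s * t' + t * s' + t * t' * sphere V); split; last by ring.
  exact: sosM.
have h := in_vars_sphere (V := V).
have ? := sos_in_vars_in_vars sV; have ? := sos_in_vars_in_vars sV'.
apply: in_varsD; last by apply: in_varsM => //; exact: in_varsM.
by apply: in_varsD; exact: in_varsM.
Qed.

Lemma cone_sos V q : sos_in_vars V q -> sphere_cone V q.
Proof.
move=> qV; exists q, 0; split=> //; first exact: in_vars0.
by rewrite mul0r addr0.
Qed.

Lemma cone_ideal V q : in_vars V q -> sphere_cone V (q * sphere V).
Proof.
by move=> qV; exists 0, q; split=> //; [exact: sos0|rewrite add0r].
Qed.

Lemma cone1 V : sphere_cone V 1.
Proof.
by apply: cone_sos; rewrite -[1]mulr1; apply/sos_sqr/in_vars1.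
Qed.

Lemma cone0 V : sphere_cone V 0.
Proof. by apply: cone_sos; exact: sos0. Qed.

Lemma coneZ V (a : R) q : 0 <= a -> sphere_cone V q -> sphere_cone V (a *: q).
Proof.
move=> a0 [s [t [sV tV ->]]]; exists (a *: s), (a *: t).
by split; [exact: sosZ|exact: in_varsZ|rewrite scalerDr scalerAl].
Qed.

Lemma cone_sum V (I : Type) (r : seq I) (P : pred I)
    (F : I -> {mpoly R[M]}) :
  (forall i, P i -> sphere_cone V (F i)) ->
  sphere_cone V (\sum_(i <- r | P i) F i).
Proof. by move=> FV; elim/big_ind: _ => //; [exact: cone0|exact: coneD]. Qed.

Lemma cone_prod V (I : Type) (r : seq I) (P : pred I)
    (F : I -> {mpoly R[M]}) :
  (forall i, P i -> sphere_cone V (F i)) ->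
  sphere_cone V (\prod_(i <- r | P i) F i).
Proof. by move=> FV; elim/big_ind: _ => //; [exact: cone1|exact: coneM]. Qed.

Lemma coneXn V q k : sphere_cone V q -> sphere_cone V (q ^+ k).
Proof.
move=> qV; elim: k => [|k IH]; first by rewrite expr0; exact: cone1.
by rewrite exprS; exact: coneM.
Qed.

(** Modulo the sphere, [1 - X_i^2] is the sum of the squares of the other
    variables. *)
Lemma cone_1BsqrX V i : i \in V -> sphere_cone V (1 - 'X_i ^+ 2).
Proof.
move=> iV; have -> : 1 - 'X_i ^+ 2 =
    \sum_(j in V :\ i) 'X_j ^+ 2 + (- 1) * sphere V :> {mpoly R[M]}.
  rewrite /sphere (big_setD1 i iV) /=; ring.
apply: coneD.
  apply: cone_sum => j; rewrite in_setD1 => /andP[_ jV].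
  by apply/cone_sos/sos_sqr/in_varsX.
by apply/cone_ideal/in_varsN/in_vars1.
Qed.

(** The two barycentric coordinates [(1 + X_i) / 2] and [(1 - X_i) / 2] of the
    interval [-1, 1] lie in the cone, since
    [2 (1 + e X_i) = (1 + e X_i)^2 + (1 - X_i^2)] when [e^2 = 1]. Bernstein
    polynomials are products of these. *)
Lemma cone_halfDX V (e : R) i : e ^+ 2 = 1 -> i \in V ->
  sphere_cone V (2^-1 *: (1 + e *: 'X_i)).
Proof.
move=> e1 iV.
have -> : 2^-1 *: (1 + e *: 'X_i) =
    (2^-1 * 2^-1) *: ((1 + e *: 'X_i) ^+ 2 + (1 - 'X_i ^+ 2)) :> {mpoly R[M]}.
  have e1' : e%:MP ^+ 2 = 1 :> {mpoly R[M]} by rewrite -rmorphXn e1 rmorph1.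
  have half : 2^-1%:MP * 2 = 1 :> {mpoly R[M]}.
    by rewrite -(mpolyC_nat M R 2) -mpolyCM mulVf ?mpolyC1 ?pnatr_eq0.
  by rewrite -!mul_mpolyC mpolyCM; ring: e1' half.
apply: coneZ; first by rewrite mulr_ge0 ?invr_ge0.
apply: coneD; last exact: cone_1BsqrX.
apply/cone_sos/sos_sqr/in_varsD; first exact: in_vars1.
by apply/in_varsZ/in_varsX.
Qed.

End SphereCone.

(** * Bernstein coefficients of powers *)

Section Bernstein.

Variable R : realType.

Definition bernstein (A : comAlgType R) (N : nat) (t u : A) (j : nat) : A :=
  'C(N, j)%:R *: (t ^+ j * u ^+ (N - j)).

(** Bernstein coefficient of [t ^+ r] in degree [N]. It is a ratio of falling
    factorials of length [r], and is close to [(j / N) ^+ r] when [N] is large. *)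
Definition falling_ratio (N r j : nat) : R := 'C(j, r)%:R / 'C(N, r)%:R.

(** Bernstein coefficient of [(t - u) ^+ k], obtained by expanding
    [(2 t - 1) ^+ k]. *)
Definition bernstein_coef (N k j : nat) : R :=
  \sum_(r < k.+1) ((-1) ^+ r * 2 ^+ (k - r) * 'C(k, r)%:R)
                  * falling_ratio N (k - r) j.

Lemma mul_bin_trinomial N r i : (i + r <= N)%N ->
  ('C(N, i + r) * 'C(i + r, r) = 'C(N, r) * 'C(N - r, i))%N.
Proof.
move=> h.
have r_N : (r <= N)%N by apply: leq_trans h; rewrite leq_addl.
have i_N : (i <= N - r)%N by rewrite leq_subRL // addnC.
have e1 := bin_fact h; have e2 := bin_fact (leq_addl i r).
have e3 := bin_fact r_N; have e4 := bin_fact i_N.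
rewrite addnK in e2; rewrite -subnDA (addnC r) in e4.
apply/eqP; rewrite -(eqn_pmul2r (fact_gt0 r)) -(eqn_pmul2r (fact_gt0 i)).
rewrite -(eqn_pmul2r (fact_gt0 (N - (i + r)))); apply/eqP.
transitivity N`!; first by rewrite -e1 -e2; ring.
by rewrite -e3 -e4; ring.
Qed.

(** Multiply [t ^+ r] by [(t + u) ^+ (N - r) = 1] and expand. *)
Lemma exp_bernstein (A : comAlgType R) N r (t u : A) :
  t + u = 1 -> (r <= N)%N ->
  t ^+ r = \sum_(j < N.+1) falling_ratio N r j *: bernstein N t u j.
Proof.
move=> tu rN.
rewrite -(big_mkord xpredT (fun j => falling_ratio N r j *: bernstein N t u j)).
rewrite (big_cat_nat (n := r)) //=; last exact: leqW.
rewrite big_nat big1 ?add0r; last first.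
  by move=> j /andP[_ jr]; rewrite /falling_ratio bin_small // mul0r scale0r.
rewrite -{2}[r]add0n big_addn subSn // big_mkord.
rewrite -[LHS]mulr1 -(expr1n _ (N - r)) -tu addrC exprDn mulr_sumr.
apply: eq_bigr => i _.
have iN : (i + r <= N)%N by rewrite addnC -leq_subRL // -ltnS.
have CNr : 'C(N, r)%:R != 0 :> R by rewrite pnatr_eq0 -lt0n bin_gt0.
have -> : falling_ratio N r (i + r) *: bernstein N t u (i + r) =
    'C(N - r, i)%:R *: (t ^+ (i + r) * u ^+ (N - (i + r))).
  rewrite /bernstein scalerA /falling_ratio; congr (_ *: _).
  rewrite mulrAC mulrC -natrM (mulnC 'C(i + r, r)) mul_bin_trinomial //.
  by rewrite natrM mulKf.
rewrite mulrnAr scaler_nat; congr (_ *+ _).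
by rewrite mulrCA -exprD mulrC (addnC r) subnDA subnAC.
Qed.

Lemma falling_ratioS N r j : (r < N)%N ->
  falling_ratio N r.+1 j =
  falling_ratio N r j * ((j - r)%:R / (N - r)%:R).
Proof.
move=> rN; rewrite /falling_ratio.
have C0 k : (k <= N)%N -> 'C(N, k)%:R != 0 :> R.
  by move=> kN; rewrite pnatr_eq0 -lt0n bin_gt0.
have N0 : (N - r)%:R != 0 :> R by rewrite pnatr_eq0 subn_eq0 -ltnNge.
have r0 : r.+1%:R != 0 :> R by rewrite pnatr_eq0.
have e k : r.+1%:R * 'C(k, r.+1)%:R = (k - r)%:R * 'C(k, r)%:R :> R.
  by rewrite -!natrM mul_bin_left.
apply: (mulfI r0); rewrite mulrA e.
have -> : 'C(N, r.+1)%:R = (N - r)%:R * 'C(N, r)%:R / r.+1%:R :> R.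
  by apply: (mulfI r0); rewrite e [RHS]mulrC divfK.
have := C0 _ (ltnW rN).
by move=> C1; field; rewrite N0 C1 nat1r.
Qed.

Lemma falling_ratio_bounds N r j : (r <= N)%N -> (j <= N)%N ->
  0 <= falling_ratio N r j <= 1.
Proof.
move=> rN jN; rewrite /falling_ratio divr_ge0 //=.
rewrite ler_pdivrMr ?mul1r ?ltr0n ?bin_gt0 // ler_nat.
exact: leq_bin2l.
Qed.

(** Each of the [r] factors [(j - i) / (N - i)] is within [i / N] of [j / N], and
    all factors lie in [0, 1], so that the errors add up. *)
Lemma falling_ratio_error N r j : (r <= N)%N -> (j <= N)%N ->
  `|falling_ratio N r j - (j%:R / N%:R) ^+ r| <= r%:R ^+ 2 / N%:R.
Proof.
move=> + jN; elim: r => [|r IH] rN.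
  by rewrite /falling_ratio !bin0 divr1 expr0 subrr normr0 divr_ge0 ?sqr_ge0.
have {}IH := IH (ltnW rN).
have N0 : 0 < N%:R :> R by rewrite ltr0n; apply: leq_ltn_trans rN.
have /andP[b0 b1] := falling_ratio_bounds (ltnW rN) jN.
rewrite falling_ratioS // exprSr.
set b := falling_ratio N r j in IH b0 b1 *.
set x := j%:R / N%:R in IH *; set y := _ / _.
have x01 : 0 <= x <= 1.
  by rewrite /x divr_ge0 //= ler_pdivrMr // mul1r ler_nat.
have xy : `|y - x| <= r%:R / N%:R.
  rewrite /y /x; have [rj|jr] := leqP r j.
    have NB : (N - r)%:R = N%:R - r%:R :> R by rewrite natrB // ltnW.
    have NB0 : 0 < N%:R - r%:R :> R by rewrite -NB ltr0n subn_gt0.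
    rewrite natrB // NB.
    have -> : (j%:R - r%:R) / (N%:R - r%:R) - j%:R / N%:R =
       - (r%:R / N%:R * ((N%:R - j%:R) / (N%:R - r%:R))) :> R.
      by field; rewrite !gt_eqF.
    have Nj : 0 <= N%:R - j%:R :> R by rewrite subr_ge0 ler_nat.
    rewrite normrN ger0_norm; last by rewrite !mulr_ge0 ?invr_ge0 // ltW.
    rewrite ler_piMr ?divr_ge0 // ler_pdivrMr // mul1r lerD2l lerN2.
    by rewrite ler_nat.
  (* The difference of naturals is truncated: binomials vanish for j < r. *)
  have -> : (j - r = 0)%N by apply/eqP; rewrite subn_eq0 ltnW.
  rewrite mul0r sub0r normrN ger0_norm ?divr_ge0 //.
  by rewrite ler_pM2r ?invr_gt0 // ler_nat ltnW.
have -> : b * y - x ^+ r * x = b * (y - x) + (b - x ^+ r) * x by ring.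
apply: le_trans (ler_normD _ _) _.
rewrite (normrM b) (normrM _ x) (ger0_norm b0).
have /andP[x0 x1] := x01; rewrite (ger0_norm x0).
have h1 : b * `|y - x| <= r%:R / N%:R.
  by apply: le_trans xy; rewrite ler_piMl.
have h2 : `|b - x ^+ r| * x <= r%:R ^+ 2 / N%:R.
  by apply: le_trans IH; rewrite ler_piMr.
apply: le_trans (lerD h1 h2) _; rewrite -mulrDl ler_pM2r ?invr_gt0 //.
rewrite -natr1; have : 0 <= r%:R :> R by []. nra.
Qed.

Lemma bernstein_coef0 N j : bernstein_coef N 0 j = 1.
Proof.
rewrite /bernstein_coef big_ord1 /falling_ratio !bin0 subnn !expr0.
by rewrite divr1 !mulr1.
Qed.

Lemma exp_sub_bernstein (A : comAlgType R) N k (t u : A) :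
  t + u = 1 -> (k <= N)%N ->
  (t - u) ^+ k = \sum_(j < N.+1) bernstein_coef N k j *: bernstein N t u j.
Proof.
move=> tu kN.
have -> : t - u = 2 *: t - 1 by rewrite -tu scaler_nat; ring.
rewrite exprBn.
under [RHS]eq_bigr => j _ do rewrite /bernstein_coef scaler_suml.
rewrite exchange_big /=; apply: eq_bigr => r _.
under eq_bigr => j _ do rewrite -scalerA.
rewrite -scaler_sumr -exp_bernstein ?(leq_trans (leq_subr _ _)) //.
rewrite expr1n mulr1 exprZn -scaler_nat.
have -> : (-1) ^+ r = ((-1) ^+ r)%:A :> A by rewrite -in_algE rmorphXn rmorphN1.
by rewrite mulr_algl !scalerA; congr (_ *: _); ring.
Qed.

(** The Bernstein coefficient with index [j] is close to the value of the
    monomial at the node [2 j / N - 1]. The constant [3 ^+ k] is the sum of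
    the absolute values of the coefficients of [(2 t - 1) ^+ k]. *)
Lemma bernstein_coef_error N k j : (k <= N)%N -> (j <= N)%N ->
  `|bernstein_coef N k j - (2 * (j%:R / N%:R) - 1) ^+ k| <=
  3 ^+ k * k%:R ^+ 2 / N%:R.
Proof.
move=> kN jN; rewrite exprBn /bernstein_coef -sumrB.
apply: le_trans (ler_norm_sum _ _ _) _.
have -> : 3 ^+ k * k%:R ^+ 2 / N%:R =
    \sum_(r < k.+1) (2 ^+ (k - r) * 'C(k, r)%:R) * (k%:R ^+ 2 / N%:R) :> R.
  rewrite -mulr_suml -mulrA; congr (_ * _).
  have -> : 3 = 2 + 1 :> R by rewrite -natr1.
  by rewrite exprDn; apply: eq_bigr => r _; rewrite expr1n mulr1 mulr_natr.
apply: ler_sum => r _.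
rewrite expr1n mulr1 exprMn -[X in _ - X]mulr_natr.
set z := j%:R / _; set m := (k - r)%N.
have -> : (-1) ^+ r * 2 ^+ m * 'C(k, r)%:R * falling_ratio N m j -
   (-1) ^+ r * (2 ^+ m * z ^+ m) * 'C(k, r)%:R =
   (-1) ^+ r * ((2 ^+ m * 'C(k, r)%:R) * (falling_ratio N m j - z ^+ m)).
  by ring.
rewrite normrMsign normrM ger0_norm; last by rewrite mulr_ge0 ?exprn_ge0.
apply: ler_wpM2l; first by rewrite mulr_ge0 ?exprn_ge0.
have mk : (m <= k)%N by exact: leq_subr.
apply: le_trans (falling_ratio_error (leq_trans mk kN) jN) _.
apply: ler_wpM2r; first by rewrite invr_ge0.
by rewrite ler_pXn2r ?nnegrE // ler_nat.
Qed.

End Bernstein.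

(** * Splitting nonnegative sums on a finite grid *)

Section GridSplitting.

Variables (R : realType) (M : nat) (G : finType).
Implicit Types (V W : {set 'I_M}) (J : {ffun 'I_M -> G}).
Implicit Types (a b h : {ffun 'I_M -> G} -> R).

Definition depends_on V a : Prop :=
  forall J J', {in V, J =1 J'} -> a J = a J'.

Lemma depends_onS V W a : V \subset W -> depends_on V a -> depends_on W a.
Proof. by move=> /subsetP VW aV J J' JJ'; apply: aV => i /VW /JJ'. Qed.

Lemma depends_onD V a b :
  depends_on V a -> depends_on V b -> depends_on V (fun J => a J + b J).
Proof. by move=> aV bV J J' JJ'; rewrite (aV _ _ JJ') (bV _ _ JJ'). Qed.

Lemma depends_onN V a : depends_on V a -> depends_on V (fun J => - a J).
Proof. by move=> aV J J' JJ'; rewrite (aV _ _ JJ'). Qed.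

Lemma min_over_fibres W b : exists h, [/\ depends_on W h,
  forall J, h J <= b J &
  forall J, exists2 J' : {ffun 'I_M -> G}, {in W, J' =1 J} & h J = b J'].
Proof.
pose agree J := [pred J' : {ffun 'I_M -> G} | [forall i in W, J' i == J i]].
pose h J := b [arg min_(J' < J | agree J J') b J']%O.
have hP J :
    (forall J' : {ffun 'I_M -> G}, {in W, J' =1 J} -> h J <= b J') /\
    (exists2 J' : {ffun 'I_M -> G}, {in W, J' =1 J} & h J = b J').
  rewrite /h; case: arg_minP => [|J0 J0J J0min]; first by apply/forall_inP.
  split=> [J' J'J|]; first by apply: J0min; apply/forall_inP => i /J'J ->.
  by exists J0 => // i iW; apply/eqP; move/forall_inP: J0J; exact.
exists h; split=> [J J' JJ'|J|J]; last 2 first.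
- by apply: (hP J).1.
- exact: (hP J).2.
have [J1 J1J e1] := (hP J).2; have [J2 J2J e2] := (hP J').2.
apply/le_anti/andP; split.
  by rewrite e2; apply: (hP J).1 => i iW; rewrite J2J // JJ'.
by rewrite e1; apply: (hP J').1 => i iW; rewrite J1J // JJ'.
Qed.

Variables (p : nat) (V : 'I_p -> {set 'I_M}).

(** A nonnegative sum of functions of the cliques is a sum of nonnegative
    functions of the same cliques. The cliques are removed from the last one
    on: the minimum [h] of its function over the coordinates that it does not
    share with earlier cliques is moved to a clique containing all shared
    coordinates. The last function minus [h] is nonnegative, and the sum of the
    others plus [h] is still nonnegative because the minimum is attained at a
    point that can be glued to any point of the earlier cliques. *)
Lemma rip_splitting (rip : running_intersection V) (k : nat)
    (b : 'I_p -> {ffun 'I_M -> G} -> R) :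
  (k <= p)%N -> (forall l, depends_on (V l) (b l)) ->
  (forall J, 0 <= \sum_(l < p | (l < k)%N) b l J) ->
  exists a : 'I_p -> {ffun 'I_M -> G} -> R,
    [/\ forall l, depends_on (V l) (a l),
        forall (l : 'I_p) J, (l < k)%N -> 0 <= a l J &
        forall J, \sum_(l < p | (l < k)%N) a l J =
                  \sum_(l < p | (l < k)%N) b l J].
Proof.
elim: k b => [|k IH] b k_p b_V b_ge0; first by exists b; split.
pose kk := Ordinal k_p.
have split_last (F : 'I_p -> R) :
    \sum_(l < p | (l < k.+1)%N) F l = F kk + \sum_(l < p | (l < k)%N) F l.
  rewrite (bigD1 kk) //=; congr (_ + _); apply: eq_bigl => l.
  by rewrite -val_eqE /= ltnS [in RHS]ltn_neqAle andbC.
have [k0|k_gt0] := posnP k.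
  exists b; split=> // l J; rewrite k0 ltnS leqn0 => l0.
  have -> : l = kk by apply: val_inj; rewrite /= k0; apply/eqP.
  move: (b_ge0 J); rewrite split_last big1 ?addr0 // => j.
  by rewrite k0.
have [s [s_k sub_s]] := rip kk k_gt0.
set U := \bigcup_(j < p | (j < kk)%N) V j in sub_s.
have [h [h_W h_le h_ex]] := min_over_fibres (V kk :&: U) (b kk).
pose b' l J := b l J + (if l == s then h J else 0).
have b'_sum J : \sum_(l < p | (l < k)%N) b' l J =
    \sum_(l < p | (l < k)%N) b l J + h J.
  rewrite /b' big_split /=; congr (_ + _).
  rewrite -big_mkcondr (big_pred1 s) // => l /=.
  by case: eqP => [->|]; rewrite ?s_k ?andbF.
have b'_V l : depends_on (V l) (b' l).
  move=> J J' JJ'; rewrite /b' (b_V l _ _ JJ'); case: eqP JJ' => [->|//] JJ'.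
  by congr (_ + _); apply: (depends_onS sub_s h_W).
have b'_ge0 J : 0 <= \sum_(l < p | (l < k)%N) b' l J.
  rewrite b'_sum; have [J' J'J ->] := h_ex J.
  (* J'' agrees with J on the earlier cliques and with J' on clique k. *)
  pose J'' := [ffun i => if i \in U then J i else J' i].
  have e1 : b kk J' = b kk J''.
    apply: b_V => i ik; rewrite ffunE; case: ifPn => // iU.
    by apply: J'J; rewrite inE ik.
  have e2 : \sum_(l < p | (l < k)%N) b l J = \sum_(l < p | (l < k)%N) b l J''.
    apply: eq_bigr => l lk; apply: b_V => i il; rewrite ffunE ifT //.
    by apply/bigcupP; exists l.
  by rewrite e1 e2 addrC -split_last.
have [a [a_V a_ge0 a_sum]] := IH b' (ltnW k_p) b'_V b'_ge0.
exists (fun l J => if l == kk then b kk J - h J else a l J); split.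
- move=> l; case: eqP => [->|_] //.
  apply: depends_onD => //; apply: depends_onN.
  by apply: depends_onS h_W; exact: subsetIl.
- move=> l J l_k; case: eqP => [_|/eqP l_kk]; first by rewrite subr_ge0.
  by apply: a_ge0; rewrite ltn_neqAle -ltnS l_k -val_eqE andbT in l_kk *.
- move=> J; rewrite !split_last eqxx.
  rewrite (eq_bigr (fun l => a l J)); last first.
    by move=> l l_k; case: eqP l_k => // ->; rewrite /= ltnn.
  by rewrite a_sum b'_sum; ring.
Qed.

End GridSplitting.

(** * Tensor Bernstein expansions *)

Section BernsteinExpansion.

Variables (R : realType) (M : nat).
Implicit Types (V : {set 'I_M}) (q : {mpoly R[M]}).

Definition bernstein_coord (N : nat) (i : 'I_M) (j : nat) : {mpoly R[M]} :=
  bernstein N (2^-1 *: (1 + 1 *: 'X_i)) (2^-1 *: (1 + (- 1) *: 'X_i)) j.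

(** Sends the function [a] on the grid of multi-indices to the polynomial having
    the values of [a] as tensor Bernstein coefficients. When [a] is
    nonnegative and only depends on the coordinates in [V], the polynomial is a
    sum of squares in the variables of [V] modulo their sphere. *)
Definition bernstein_comb N (a : {ffun 'I_M -> 'I_N.+1} -> R) : {mpoly R[M]} :=
  \sum_J a J *: \prod_i bernstein_coord N i (J i).

Lemma expX_bernstein_coord N i k : (k <= N)%N ->
  'X_i ^+ k = \sum_(j < N.+1) bernstein_coef R N k j *: bernstein_coord N i j.
Proof.
move=> kN; rewrite /bernstein_coord -exp_sub_bernstein //.
  congr (_ ^+ _); rewrite -scalerBr scale1r scaleN1r opprD opprK addrACA.
  rewrite subrr add0r.
  by rewrite -mulr2n -scaler_nat scalerA mulVf ?scale1r ?pnatr_eq0.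
rewrite -scalerDr scale1r scaleN1r addrACA subrr addr0.
by rewrite -mulr2n -scaler_nat scalerA mulVf ?scale1r ?pnatr_eq0.
Qed.

Lemma sum_bernstein_coord N i : \sum_(j < N.+1) bernstein_coord N i j = 1.
Proof.
rewrite -(expr0 'X_i) (expX_bernstein_coord _ (leq0n N)).
by apply: eq_bigr => j _; rewrite bernstein_coef0 scale1r.
Qed.

Lemma cone_bernstein_coord V N i j :
  i \in V -> sphere_cone V (bernstein_coord N i j).
Proof.
move=> iV; apply: coneZ => //.
apply: coneM; apply: coneXn; apply: cone_halfDX; rewrite // ?expr1n //.
by rewrite sqrrN expr1n.
Qed.

(** Bernstein polynomials in one variable sum to 1, so that summing over the
    coordinates outside [V] leaves a nonnegative combination of products of
    Bernstein polynomials in the variables of [V]. *)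
Lemma cone_bernstein_comb V N (a : {ffun 'I_M -> 'I_N.+1} -> R) :
  depends_on V a -> (forall J, 0 <= a J) -> sphere_cone V (bernstein_comb a).
Proof.
move=> aV a_ge0.
(* rho J forgets the coordinates of J outside V, and the sum is grouped along
   the fibres of rho. *)
pose rho (J : {ffun 'I_M -> 'I_N.+1}) : {ffun 'I_M -> 'I_N.+1} :=
  [ffun i => if i \in V then J i else ord0].
rewrite /bernstein_comb (partition_big rho xpredT) //=.
apply: cone_sum => J0 _.
have a_J0 J : rho J == J0 -> a J = a J0.
  by move=> /eqP <-; apply: aV => i iV; rewrite ffunE iV.
rewrite (eq_bigr (fun J : {ffun 'I_M -> 'I_N.+1} =>
  a J0 *: \prod_i bernstein_coord N i (J i))); last first.
  by move=> J /a_J0 ->.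
rewrite -scaler_sumr; apply: coneZ => //.
have [fixJ0|movJ0] := eqVneq (rho J0) J0; last first.
  rewrite big1; first exact: cone0.
  move=> J /eqP e; case/eqP: movJ0; rewrite -e; apply/ffunP => i.
  by rewrite !ffunE; case: (i \in V).
pose Q i : pred 'I_N.+1 := if i \in V then pred1 (J0 i) else predT.
rewrite (eq_bigl (fun J : {ffun 'I_M -> 'I_N.+1} => J \in family Q));
  last first.
  move=> J; apply/eqP/familyP => [e i|JQ].
    by rewrite /Q -e ffunE; case: (i \in V); rewrite !inE.
  apply/ffunP => i; rewrite ffunE -fixJ0 ffunE.
  by have := JQ i; rewrite /Q; case: ifP => // _; rewrite inE => /eqP.
rewrite -(bigA_distr_big_dep _ (fun i j => bernstein_coord N i (nat_of_ord j))).
apply: cone_prod => i _; rewrite /Q; case: ifP => iV.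
  by rewrite big_pred1_eq; exact: cone_bernstein_coord.
by rewrite sum_bernstein_coord; exact: cone1.
Qed.

(** The tensor Bernstein coefficients of [q] in degree [N]. *)
Definition grid_coef N q (J : {ffun 'I_M -> 'I_N.+1}) : R :=
  \sum_(m <- msupp q) q@_m * \prod_i bernstein_coef R N (m i) (J i).

(** A variable absent from a monomial contributes the constant coefficient 1. *)
Lemma depends_on_grid_coef V N q :
  in_vars V q -> depends_on V (@grid_coef N q).
Proof.
move=> qV J J' JJ'; rewrite /grid_coef !big_seq; apply: eq_bigr => m mq.
congr (_ * _); apply: eq_bigr => i _.
have [->|/(qV _ mq) iV] := eqVneq (m i) 0%N; first by rewrite !bernstein_coef0.
by rewrite JJ'.
Qed.

Lemma bernstein_comb_grid_coef N q :
  (forall m, m \in msupp q -> forall i, (m i <= N)%N) ->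
  bernstein_comb (@grid_coef N q) = q.
Proof.
move=> degq; rewrite [RHS]mpolyE /bernstein_comb /grid_coef.
under eq_bigr => J _ do rewrite scaler_suml.
rewrite exchange_big /= !big_seq; apply: eq_bigr => m mq.
under eq_bigr => J _ do rewrite -scalerA.
rewrite -scaler_sumr; congr (_ *: _).
rewrite mpolyXE_id.
under [RHS]eq_bigr => i _ do rewrite (expX_bernstein_coord _ (degq m mq i)).
rewrite bigA_distr_bigA /=; apply: eq_bigr => J _.
by rewrite [RHS]scaler_prod.
Qed.

Lemma prod_close (I : Type) (r : seq I) (x y : I -> R) (e : R) :
  e <= 1 -> (forall i, `|y i| <= 1) -> (forall i, `|x i - y i| <= e) ->
  `|\prod_(i <- r) x i - \prod_(i <- r) y i| <= (2 ^+ size r - 1) * e.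
Proof.
move=> e1 y1 xy.
elim: r => [|i r IH]; first by rewrite !big_nil subrr normr0 mul0r.
rewrite !big_cons /=; set X := \prod_(j <- r) x j in IH *.
set Y := \prod_(j <- r) y j in IH *.
have Y1 : `|Y| <= 1.
  rewrite /Y normr_prod; elim/big_rec: _ => // k a _ a1.
  by apply: le_trans (ler_wpM2l (normr_ge0 _) a1) _; rewrite mulr1.
have -> : x i * X - y i * Y = x i * (X - Y) + (x i - y i) * Y by ring.
apply: le_trans (ler_normD _ _) _; rewrite !normrM.
have xi2 : `|x i| <= 2.
  rewrite -[x i](subrK (y i)); apply: le_trans (ler_normD _ _) _.
  rewrite [leRHS](_ : 2 = 1 + 1) ?mulr2n //.
  by apply: lerD => //; exact: le_trans (xy i) e1.
have -> : (2 ^+ (size r).+1 - 1) * e = 2 * ((2 ^+ size r - 1) * e) + e * 1.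
  by rewrite exprS; ring.
by apply: lerD; rewrite ler_pM.
Qed.

Definition grid_point N (J : {ffun 'I_M -> 'I_N.+1}) (i : 'I_M) : R :=
  2 * ((J i)%:R / N%:R) - 1.

Lemma grid_point_box N J : in_box 1 (@grid_point N J).
Proof.
move=> i; rewrite /grid_point.
have : 0 <= (J i)%:R / N%:R :> R by rewrite divr_ge0.
have : (J i)%:R / N%:R <= 1 :> R.
  have [N0|N0] := posnP N; first by rewrite [in N%:R]N0 invr0 mulr0.
  by rewrite ler_pdivrMr ?ltr0n // mul1r ler_nat -ltnS.
by rewrite ler_norml; lra.
Qed.

(** In high degree the Bernstein coefficients of [q] are uniformly close to the
    values of [q] at the grid points; in particular those of a polynomial
    positive on the cube become positive. *)
Lemma grid_coef_close q (e : R) : 0 < e -> exists N0, forall N, (N0 <= N)%N ->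
  (forall m, m \in msupp q -> forall i, (m i <= N)%N) /\
  forall J, `|@grid_coef N q J - q.@[grid_point J]| <= e.
Proof.
move=> e0; set D := msize q.
pose K : R := \sum_(m <- msupp q) `|q@_m| * (2 ^+ M * (3 ^+ D * D%:R ^+ 2)).
have K0 : 0 <= K by apply: sumr_ge0 => m _; rewrite !mulr_ge0 ?exprn_ge0.
have degq m : m \in msupp q -> forall i, (m i <= D)%N.
  move=> mq i; apply: leq_trans (ltnW (msize_mdeg_lt mq)).
  by rewrite mdegE (bigD1 i) //= leq_addr.
exists (maxn D.+1 (maxn (3 ^ D * D ^ 2) (Num.bound (K / e)))) => N.
rewrite !geq_max => /and3P[ND N1 NK].
have N0 : 0 < N%:R :> R by rewrite ltr0n; apply: leq_trans ND.
split=> [m mq i|J]; first exact: leq_trans (degq m mq i) (ltnW ND).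
rewrite /grid_coef mevalE -sumrB; apply: le_trans (ler_norm_sum _ _ _) _.
have KN : K / N%:R <= e.
  rewrite ler_pdivrMr // mulrC -ler_pdivrMr //.
  have /archi_boundP/ltW h : 0 <= K / e by rewrite divr_ge0 // ltW.
  by apply: le_trans h _; rewrite ler_nat.
apply: le_trans KN; rewrite /K mulr_suml !big_seq; apply: ler_sum => m mq.
rewrite -mulrBr normrM -mulrA ler_wpM2l //.
pose eN : R := 3 ^+ D * D%:R ^+ 2 / N%:R.
have eN0 : 0 <= eN by rewrite divr_ge0 // mulr_ge0 ?exprn_ge0.
have eN1 : eN <= 1.
  by rewrite ler_pdivrMr // mul1r -!natrX -natrM ler_nat.
have sM : size (index_enum 'I_M) = M.
  by rewrite -sum1_size -[RHS](card_ord M) -sum1_card; apply: eq_bigl.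
apply: le_trans (prod_close (e := eN) (index_enum 'I_M) eN1 _ _) _ => [i|i|].
- by rewrite normrX exprn_ile1 //; exact: grid_point_box.
- have mD := degq m mq i.
  apply: le_trans (bernstein_coef_error _ (leq_trans mD (ltnW ND)) _) _.
    by rewrite -ltnS.
  rewrite ler_pM2r ?invr_gt0 // ler_pM ?exprn_ge0 //.
    by rewrite ler_eXn2l // ltr1n.
  by rewrite ler_pXn2r ?nnegrE // ler_nat.
- by rewrite sM -mulrA -/eN mulrBl lerBlDr lerDl mul1r.
Qed.

End BernsteinExpansion.

(** * A sparse Positivstellensatz for spheres *)

Section Sparse.

Variables (R : realType) (M : nat).
Implicit Types (V : {set 'I_M}) (q g : {mpoly R[M]}).

Lemma mpoly_ring_ind (P : {mpoly R[M]} -> Prop) :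
  (forall a, P a%:MP) -> (forall i, P 'X_i) ->
  (forall q g, P q -> P g -> P (q + g)) ->
  (forall q g, P q -> P g -> P (q * g)) ->
  forall q, P q.
Proof.
move=> PC PX PD PM q; rewrite [q]mpolyE.
have P1 : P 1 by rewrite -mpolyC1; exact: PC.
have PXn i k : P ('X_i ^+ k).
  by elim: k => [|k IH]; rewrite ?expr0 // exprS; exact: PM.
have P0 : P 0 by rewrite -mpolyC0; exact: PC.
apply: (big_ind P P0 PD).
move=> m _; rewrite -mul_mpolyC; apply: (PM); first exact: PC.
by rewrite mpolyXE_id; apply: (big_ind P P1 PM) => i _; exact: PXn.
Qed.

Lemma meval_box_bounded (r : R) q :
  exists2 B : R, 0 <= B & forall v, in_box r v -> `|q.@[v]| <= B.
Proof.
elim/mpoly_ring_ind: q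
  => [a|i|q g [B B0 qB] [B' B0' gB]|q g [B B0 qB] [B' B0' gB]].
- by exists `|a| => // v _; rewrite mevalC.
- exists `|r| => // v vr; rewrite mevalXU; exact: le_trans (vr i) (ler_norm r).
- exists (B + B'); first exact: addr_ge0.
  move=> v vr; rewrite mevalD; apply: le_trans (ler_normD _ _) _.
  by apply: lerD; [exact: qB|exact: gB].
- exists (B * B'); first exact: mulr_ge0.
  by move=> v vr; rewrite mevalM normrM ler_pM //; [exact: qB|exact: gB].
Qed.

Lemma meval_box_lipschitz (r : R) q :
  exists2 L : R, 0 <= L & box_lipschitz r L (fun v => q.@[v]).
Proof.
elim/mpoly_ring_ind: q
  => [a|i|q g [L L0 qL] [L' L0' gL]|q g [L L0 qL] [L' L0' gL]].
- by exists 0 => // u v _ _ e _; rewrite !mevalC subrr normr0 mul0r.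
- by exists 1 => // u v _ _ e uv; rewrite !mevalXU mul1r.
- exists (L + L'); first exact: addr_ge0.
  move=> u v ur vr e uv; rewrite !mevalD opprD addrACA mulrDl.
  by apply: le_trans (ler_normD _ _) _; apply: lerD; [exact: qL|exact: gL].
- have [B B0 qB] := meval_box_bounded r q.
  have [B' B0' gB] := meval_box_bounded r g.
  exists (B * L' + B' * L); first by rewrite addr_ge0 ?mulr_ge0.
  move=> u v ur vr e uv; rewrite !mevalM.
  have -> : q.@[u] * g.@[u] - q.@[v] * g.@[v] =
    q.@[u] * (g.@[u] - g.@[v]) + g.@[v] * (q.@[u] - q.@[v]) by ring.
  apply: le_trans (ler_normD _ _) _; rewrite mulrDl -!mulrA !normrM.
  apply: lerD; apply: ler_pM => //; [exact: qB|exact: gL|exact: gB|exact: qL].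
Qed.

(** The sum of the Bernstein coefficients of the [F l] is nonnegative at every
    grid point once the degree is high enough. Splitting it on the grid and
    going back to polynomials requires no further approximation, since both
    passages between polynomials and coefficients are exact. *)
Lemma sparse_cube_certificate (p : nat) (V : 'I_p -> {set 'I_M})
    (rip : running_intersection V)
    (F : 'I_p -> {mpoly R[M]}) (delta : R) :
  (forall l, in_vars (V l) (F l)) -> 0 < delta ->
  (forall v, in_box 1 v -> delta <= (\sum_l F l).@[v]) ->
  exists2 G : 'I_p -> {mpoly R[M]},
    forall l, sphere_cone (V l) (G l) & \sum_l F l = \sum_l G l.
Proof.
move=> FV d0 F_pos.
pose e := delta / p.+1%:R.
have e0 : 0 < e by rewrite divr_gt0.
have [N0 N0P] := fin_all_exists (fun l => grid_coef_close (F l) e0).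
pose N := \max_l N0 l.
have N0N l : (N0 l <= N)%N by exact: leq_bigmax.
pose b l := @grid_coef R M N (F l).
have all_lt (H : 'I_p -> R) : \sum_(l < p | (l < p)%N) H l = \sum_l H l.
  by apply: eq_bigl => l; rewrite ltn_ord.
have b_ge0 J : 0 <= \sum_(l < p | (l < p)%N) b l J.
  have := F_pos _ (grid_point_box R J); rewrite rmorph_sum /= => Fd.
  have close : \sum_l (F l).@[grid_point R J] - e *+ p <=
      \sum_(l < p | (l < p)%N) b l J.
    rewrite -[p in _ *+ p](card_ord p) -sumr_const -sumrB.
    rewrite all_lt.
    apply: ler_sum => l _; have [_ /(_ J)] := N0P l N (N0N l).
    by rewrite ler_norml lerBlDr lerBrDr => /andP[]; rewrite addrC /b; lra.
  apply: le_trans close; rewrite subr_ge0; apply: le_trans Fd.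
  by rewrite /e -mulr_natr mulrAC ler_pdivrMr // ler_wpM2l ?ler_nat // ltW.
have [a [aV a_ge0 a_sum]] := rip_splitting rip (leqnn p)
  (fun l => depends_on_grid_coef (N := N) (FV l)) b_ge0.
exists (fun l => bernstein_comb (a l)) => [l|].
  by apply: cone_bernstein_comb => // J; apply: a_ge0.
transitivity (\sum_l bernstein_comb (b l)).
  apply: eq_bigr => l _; rewrite bernstein_comb_grid_coef //.
  by have [] := N0P l N (N0N l).
rewrite /bernstein_comb exchange_big [RHS]exchange_big /=.
apply: eq_bigr => J _.
rewrite -!scaler_suml; congr (_ *: _).
by have := a_sum J; rewrite !all_lt.
Qed.

(** Sparse Putinar Positivstellensatz for spheres. Adding [C] times the square of
    each sphere polynomial reduces positivity on the intersection of the
    spheres to positivity on the cube, keeps the sparsity pattern, and changes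
    every summand by an element of the ideal of its sphere only. *)
Theorem sparse_sphere_positivstellensatz (p : nat) (V : 'I_p -> {set 'I_M})
    (rip : running_intersection V)
    (F : 'I_p -> {mpoly R[M]}) :
  (forall l, in_vars (V l) (F l)) ->
  (forall v, (forall l, (sphere R (V l)).@[v] = 0) -> 0 < (\sum_l F l).@[v]) ->
  exists2 G : 'I_p -> {mpoly R[M]},
    forall l, sphere_cone (V l) (G l) & \sum_l F l = \sum_l G l.
Proof.
move=> FV F_pos; pose S := \sum_l sphere R (V l) ^+ 2.
have [||v _|v _|C [delta [C0 d0 FS]]] := @Compactness.box_penalty R M 1
   (fun v => (\sum_l F l).@[v]) (fun v => S.@[v]).
- exact: meval_box_lipschitz.
- exact: meval_box_lipschitz.
- by rewrite /S rmorph_sum /= sumr_ge0 // => l _; rewrite rmorphXn sqr_ge0.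
- rewrite /S rmorph_sum /= => /eqP.
  rewrite psumr_eq0; last by move=> l _; rewrite rmorphXn sqr_ge0.
  move=> /allP S0; apply: F_pos => l.
  have := S0 l (mem_index_enum l); rewrite rmorphXn sqrf_eq0 => /eqP; exact.
pose F' l := F l + C *: sphere R (V l) ^+ 2.
have F'E : \sum_l F' l = \sum_l F l + C *: S.
  by rewrite big_split /= scaler_sumr.
have F'V l : in_vars (V l) (F' l).
  by apply: in_varsD => //; apply/in_varsZ/in_varsXn/in_vars_sphere.
have F'_pos v : in_box 1 v -> delta <= (\sum_l F' l).@[v].
  by move=> /FS; rewrite F'E mevalD mevalZ.
have [G GV GE] := sparse_cube_certificate rip F'V d0 F'_pos.
exists (fun l => G l + (- C *: sphere R (V l)) * sphere R (V l)).
  by move=> l; apply: coneD => //; apply/cone_ideal/in_varsZ/in_vars_sphere.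
rewrite big_split /= -GE F'E -addrA /S scaler_sumr -big_split /=.
rewrite -[LHS]addr0; congr (_ + _); symmetry; apply: big1 => l _.
by rewrite -scalerAl -expr2 scaleNr subrr.
Qed.

End Sparse.

(** * Nonvanishing of polynomials, and homogenization *)

Section Nonvanishing.

Variables (R : realType).

Lemma poly_nonroot (P : {poly R}) : P != 0 -> exists t, P.[t] != 0.
Proof.
move=> P0; pose rs : seq R := [seq k%:R | k <- iota 0 (size P)].
have rs_uniq : uniq rs.
  rewrite map_inj_uniq ?iota_uniq // => k k' /eqP.
  by rewrite eqr_nat => /eqP.
have := contraNN (fun a => max_poly_roots P0 a rs_uniq).
rewrite size_map size_iota ltnn => /(_ isT) /allPn[t _ Pt].
by exists t.
Qed.

Lemma digits_inj (B n : nat) (a b : 'I_n -> nat) :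
  (forall i, (a i < B)%N) -> (forall i, (b i < B)%N) ->
  (\sum_i a i * B ^ i = \sum_i b i * B ^ i)%N -> a =1 b.
Proof.
elim: n a b => [|n IH] a b aB bB; first by move=> _ [].
rewrite !big_ord_recl expn0 !muln1.
have B0 : (0 < B)%N by apply: leq_ltn_trans (aB ord0).
have shift (x : 'I_n.+1 -> nat) :
    (\sum_(i < n) x (lift ord0 i) * B ^ lift ord0 i =
    (\sum_(i < n) x (lift ord0 i) * B ^ i) * B)%N.
  rewrite big_distrl /=; apply: eq_bigr => i _.
  by rewrite /bump add1n expnSr mulnA.
rewrite !shift => e.
have e0 : a ord0 = b ord0.
  have := congr1 (modn^~ B) e.
  by rewrite /= addnC modnMDl [in RHS]addnC modnMDl !modn_small.
move: e; rewrite e0 => /addnI/eqP; rewrite eqn_pmul2r // => /eqP e i.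
case: (unliftP ord0 i) => [j|] -> //.
by apply: (IH (fun j => a (lift ord0 j)) (fun j => b (lift ord0 j))).
Qed.

(** Kronecker substitution [x_i = t ^ (B ^ i)], with [B] above all exponents, maps
    distinct monomials to distinct powers of [t]. *)
Lemma mpoly_nonroot n (q : {mpoly R[n]}) : q != 0 -> exists v, q.@[v] != 0.
Proof.
move=> q0; pose B := msize q.
pose kappa (m : 'X_{1..n}) := (\sum_(i < n) m i * B ^ i)%N.
have mB m : m \in msupp q -> forall i, (m i < B)%N.
  move=> mq i; apply: leq_ltn_trans (msize_mdeg_lt mq).
  by rewrite mdegE (bigD1 i) //= leq_addr.
pose P : {poly R} := \sum_(m <- msupp q) q@_m *: 'X^(kappa m).
have [m0 m0q] : exists m0, m0 \in msupp q.
  by exists (mlead q); exact: mlead_supp.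
have P0 : P != 0.
  apply/eqP => /(congr1 (fun P : {poly R} => P`_(kappa m0))).
  rewrite coef0 coef_sum (bigD1_seq m0) ?msupp_uniq //= coefZ coefXn eqxx mulr1.
  rewrite big_seq_cond big1 ?addr0 => [/eqP|m /andP[mq m_m0]].
    by rewrite mcoeff_eq0 m0q.
  rewrite coefZ coefXn; case: eqP => [e|]; last by rewrite mulr0.
  case/eqP: m_m0; apply/mnmP.
  by apply: (digits_inj (mB _ mq) (mB _ m0q)).
have [t Pt] := poly_nonroot P0.
exists (fun i => t ^+ (B ^ i)); rewrite mevalE.
suff <- : P.[t] =
    \sum_(m <- msupp q) q@_m * \prod_(i < n) (t ^+ (B ^ i)) ^+ m i by [].
rewrite horner_sum; apply: eq_bigr => m _.
rewrite hornerZ hornerXn; congr (_ * _).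
by rewrite /kappa expr_sum; apply: eq_bigr => i _; rewrite mulnC exprM.
Qed.

End Nonvanishing.

Section Homogenization.

Variables (R : realType) (n p : nat).
Implicit Types (f g : {mpoly R[n]}) (c : 'I_p -> {set 'I_n}).

(** Summing over any list containing the support makes the homogenization
    visibly linear. Linearity also covers summands of degree above [d], whose
    truncated exponents [d - mdeg m] are all 0: these monomials cancel in the
    sum over the cliques. *)
Lemma homogenization_wide (d : nat) f (r : seq 'X_{1..n}) :
  uniq r -> {subset msupp f <= r} ->
  homogenization p d f =
    \sum_(m <- r) f@_m *: ('X_(ix p ord0) ^+ (d - mdeg m)
              * \prod_(i < n) 'X_(ix p (lift ord0 i)) ^+ (m i)).
Proof.
move=> r_uniq f_r.
rewrite -[RHS](@big_rmcond _ _ _ _ _ [pred m | m \in msupp f]).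
  rewrite -big_filter; apply: perm_big; apply: uniq_perm.
  - exact: msupp_uniq.
  - exact: filter_uniq.
  - move=> m; rewrite mem_filter /=.
    by case: (boolP (m \in msupp f)) => // /f_r ->.
by move=> m /= m_f; rewrite memN_msupp_eq0 // scale0r.
Qed.

Lemma homogenizationD (d : nat) f g :
  homogenization p d (f + g) = homogenization p d f + homogenization p d g.
Proof.
pose r := undup (msupp (f + g) ++ msupp f ++ msupp g).
have wide (h : {mpoly R[n]}) :
    {subset msupp h <= msupp (f + g) ++ msupp f ++ msupp g} ->
    homogenization p d h =
    \sum_(m <- r) h@_m *: ('X_(ix p ord0) ^+ (d - mdeg m)
              * \prod_(i < n) 'X_(ix p (lift ord0 i)) ^+ (m i)).
  move=> sub; apply: homogenization_wide; first exact: undup_uniq.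
  by move=> m /sub; rewrite mem_undup.
rewrite !wide -?big_split /=.
- by apply: eq_bigr => m _; rewrite mcoeffD scalerDl.
- by move=> m ms; rewrite !mem_cat ms !orbT.
- by move=> m ms; rewrite !mem_cat ms !orbT.
- by move=> m ms; rewrite !mem_cat ms.
Qed.

Lemma homogenization_sum (d : nat) (g : 'I_p -> {mpoly R[n]}) :
  homogenization p d (\sum_l g l) = \sum_l homogenization p d (g l).
Proof.
apply: (big_morph _ (homogenizationD d)).
by rewrite /homogenization msupp0 big_nil.
Qed.

Lemma ix_lift_clique_vars c l i :
  i \in c l -> ix p (lift ord0 i) \in clique_vars c l.
Proof. by move=> il; rewrite inE; apply/orP; right; apply/imsetP; exists i. Qed.

Lemma in_vars_homogenization c l (d : nat) g :
  in_vars (c l) g -> in_vars (clique_vars c l) (homogenization p d g).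
Proof.
move=> g_c; rewrite /homogenization big_seq; apply: in_vars_sum => m mg.
apply: in_varsZ; apply: in_varsM.
  by apply/in_varsXn/in_varsX; rewrite !inE eqxx.
apply: in_vars_prod => i _.
have [->|/(g_c _ mg) i_c] := eqVneq (m i) 0%N.
  by rewrite expr0; exact: in_vars1.
by apply/in_varsXn/in_varsX/ix_lift_clique_vars.
Qed.

Lemma ix_inj : injective (@ix n p).
Proof. exact: lshift_inj. Qed.

Lemma homogenization_at_infinity (d : nat) f (v : 'I_(n.+1 + p) -> R) :
  (msize f <= d.+1)%N -> v (ix p ord0) = 0 ->
  (homogenization p d f).@[v] =
  (pihomog mdeg d f).@[fun i => v (ix p (lift ord0 i))].
Proof.
move=> sz_f v0; rewrite /homogenization pihomogE !rmorph_sum /=.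
rewrite [RHS]big_mkcond !big_seq /=; apply: eq_bigr => m m_f.
rewrite mevalZ mevalM rmorphXn /= mevalXU v0.
have le_md : (mdeg m <= d)%N.
  by rewrite -ltnS; apply: leq_trans (msize_mdeg_lt m_f) sz_f.
case: eqP => [->|/eqP ne]; last first.
  by rewrite expr0n subn_eq0 leqNgt ltn_neqAle ne le_md mul0r mulr0.
rewrite subnn expr0 mul1r mevalZ mevalX rmorph_prod /=; congr (_ * _).
by apply: eq_bigr => i _; rewrite rmorphXn /= mevalXU.
Qed.

(** The variable [x_0] is in all cliques and each [w_l] is in a single one, so
    that the old intersections only grow by [x_0]. *)
Lemma clique_vars_rip c :
  running_intersection c -> running_intersection (clique_vars c).
Proof.
move=> rip k k0; have [s [sk sub]] := rip k k0; exists s; split=> //.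
apply/subsetP => i; rewrite inE => /andP[ik /bigcupP[j jk ij]].
move: ik; rewrite /clique_vars !inE -orbA.
move=> /or3P[-> //|/eqP ei|/imsetP[x xk ei]].
  move: ij; rewrite ei /clique_vars !inE => /orP[/orP[|]|/imsetP[y _]].
  - by rewrite eq_rlshift.
  - by move=> /eqP/rshift_inj e; rewrite e ltnn in jk.
  - by move/eqP; rewrite eq_rlshift.
move: ij; rewrite ei /clique_vars !inE.
move=> /orP[/orP[|]|/imsetP[y yj /ix_inj/lift_inj e]].
- by move/eqP/ix_inj.
- by rewrite eq_lrshift.
have := @ix_lift_clique_vars c s x; rewrite /clique_vars !inE; apply.
apply: (subsetP sub); rewrite inE xk /=.
by apply/bigcupP; exists j => //; rewrite e.
Qed.

Lemma clique_sphereE c l : clique_sphere R c l = sphere R (clique_vars c l).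
Proof.
rewrite /clique_sphere /sphere /clique_vars; congr (_ - 1).
rewrite -setUA big_setU1 /=; last first.
  rewrite !inE negb_or eq_lrshift /=; apply/imsetP => -[x _ /ix_inj].
  by move/eqP; rewrite (negPf (neq_lift _ _)).
rewrite big_setU1 /=; last first.
  by apply/imsetP => -[x _ /eqP]; rewrite eq_rlshift.
rewrite big_imset /=; last by move=> x y _ _ /ix_inj/lift_inj.
by rewrite -addrA; congr (_ + _); rewrite addrC.
Qed.

End Homogenization.

(** * Positivity on the spheres *)

Section Positivity.

Variables (R : realType) (n p : nat).
Implicit Types (f g : {mpoly R[n]}) (c : 'I_p -> {set 'I_n}).

Lemma meval_ge0_limit (M : nat) (q : {mpoly R[M]}) (i0 : 'I_M) (v : 'I_M -> R) :
  v i0 = 0 ->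
  (forall t, 0 < t -> 0 <= q.@[fun i => if i == i0 then t else v i]) ->
  0 <= q.@[v].
Proof.
move=> v0 q_ge0; rewrite leNgt; apply/negP => qv.
pose r : R := 1 + \sum_i `|v i|.
have vr : in_box r v.
  move=> i; rewrite /r (bigD1 i) //= addrCA lerDl addr_ge0 // sumr_ge0 //.
have [L L0 lipL] := meval_box_lipschitz r q.
pose a := - q.@[v]; have a0 : 0 < a by rewrite oppr_gt0.
have La : 0 < L + 1 + a by rewrite addr_gt0 // ltr_wpDl.
(* t is at most 1, to stay in the box, and L * t < a. *)
pose t := a / (L + 1 + a).
have t0 : 0 < t by rewrite divr_gt0.
have t1 : t <= 1 by rewrite ler_pdivrMr // mul1r lerDr addr_ge0.
pose vt i := if i == i0 then t else v i.
have vtr : in_box r vt.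
  move=> i; rewrite /vt; case: eqP => // _; rewrite ger0_norm ?(ltW t0) //.
  by apply: le_trans t1 _; rewrite /r lerDl sumr_ge0.
have close i : `|vt i - v i| <= t.
  rewrite /vt; case: eqP => [->|_]; first by rewrite v0 subr0 gtr0_norm.
  by rewrite subrr normr0 ltW.
have := lipL _ _ vtr vr t close; have := q_ge0 t t0; rewrite -/vt.
have : L * t < a.
  rewrite /t mulrCA -[ltRHS]mulr1 ltr_pM2l // ltr_pdivrMr // mul1r -addrA.
  by rewrite ltrDl addr_gt0.
rewrite ler_norml /a => h1 h2 /andP[_]; move: h1 h2; lra.
Qed.

(** At infinity the homogenization is a limit of values at positive [x_0], where
    its sign is that of [f] whatever the parity of [d]. *)
Lemma homogenization_infinity_ge0 (d : nat) f (v : 'I_(n.+1 + p) -> R) :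
  (msize f <= d.+1)%N -> (forall x, 0 <= f.@[x]) ->
  v (ix p ord0) = 0 -> 0 <= (homogenization p d f).@[v].
Proof.
move=> sz_f f_ge0 v0; apply: (meval_ge0_limit v0) => t t0.
rewrite homogenizationE ?eqxx ?gt_eqF //.
by rewrite mulr_ge0 // exprn_ge0 // ltW.
Qed.

Lemma homogenization_ge0 (d : nat) f (v : 'I_(n.+1 + p) -> R) :
  (msize f <= d.+1)%N -> ~~ odd d -> (forall x, 0 <= f.@[x]) ->
  0 <= (homogenization p d f).@[v].
Proof.
move=> sz_f ev f_ge0.
have [v0|v0] := eqVneq (v (ix p ord0)) 0.
  exact: homogenization_infinity_ge0.
by rewrite homogenizationE // mulr_ge0 // exprn_even_ge0.
Qed.

(** A nonzero leading form of odd degree would take a negative value, although its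
    values are limits of nonnegative values of the homogenization. Evenness is
    what makes the powers [x_i^d] and [w_l^d] of the perturbation nonnegative. *)
Lemma nonneg_even_degree f :
  (forall x, 0 <= f.@[x]) -> ~~ odd (msize f).-1.
Proof.
move=> f_ge0; apply/negP => d_odd; set d := (msize f).-1 in d_odd.
have f0 : f != 0.
  by apply/eqP => f0; move: d_odd; rewrite /d f0 msize0.
have sz_f : msize f = d.+1 by rewrite /d -(mlead_deg f0).
pose top := pihomog mdeg d f.
have top0 : top != 0.
  rewrite -msupp_eq0.
  suff : mlead f \in msupp top by case: (msupp top).
  rewrite /top pihomogE -big_filter (perm_mem (msupp_sumX _ _)).
  - by rewrite mem_filter mlead_supp // andbT /= -eqSS mlead_deg // sz_f.
  - by rewrite filter_uniq.
  - by move=> m; rewrite mem_filter mcoeff_msupp => /andP[].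
have top_odd (x : 'I_n -> R) : top.@[fun i => - x i] = - top.@[x].
  rewrite /top pihomogE !rmorph_sum /= -sumrN; apply: eq_bigr => m /eqP dm.
  rewrite !mevalZ !mevalX -mulrN; congr (_ * _).
  rewrite (eq_bigr (fun i => (-1) ^+ m i * x i ^+ m i)); last first.
    by move=> i _; exact: exprNn.
  by rewrite big_split /= prodrXr -mdegE dm -signr_odd d_odd expr1 mulN1r.
have [x x0] : exists x, top.@[x] < 0.
  have [x] := mpoly_nonroot top0; rewrite neq_lt.
  move=> /orP[h|h]; first by exists x.
  by exists (fun i => - x i); rewrite top_odd oppr_lt0.
pose v (i : 'I_(n.+1 + p)) : R :=
  if split i is inl j then (if unlift ord0 j is Some k then x k else 0) else 0.
have v0 : v (ix p ord0) = 0.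
  rewrite /v /ix; have := unsplitK (inl ord0 : 'I_n.+1 + 'I_p).
  by rewrite /= => ->; rewrite unlift_none.
have := homogenization_infinity_ge0 (eq_leq sz_f) f_ge0 v0.
rewrite homogenization_at_infinity ?sz_f // leNgt => /negP; apply.
rewrite -/top (_ : top.@[_] = top.@[x]) //; apply: meval_eq => k.
rewrite /v /ix; have := unsplitK (inl (lift ord0 k) : 'I_n.+1 + 'I_p).
by rewrite /= => ->; rewrite liftK.
Qed.

Lemma sphere_point_nonzero (M : nat) (V : {set 'I_M}) (v : 'I_M -> R) :
  (sphere R V).@[v] = 0 -> exists2 i, i \in V & v i != 0.
Proof.
move=> sv.
have [/exists_inP//|/exists_inPn v0] := boolP [exists i in V, v i != 0].
move/eqP: sv; rewrite /sphere mevalB rmorph_sum /= meval1 big1.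
  by rewrite sub0r oppr_eq0 oner_eq0.
move=> i iV; rewrite rmorphXn /= mevalXU.
by have /negPn/eqP -> := v0 i iV; rewrite expr0n.
Qed.

Lemma sparse_certificate (c : 'I_p -> {set 'I_n})
    (F : 'I_p -> {mpoly R[n.+1 + p]}) :
  running_intersection c ->
  (forall l, in_vars (clique_vars c l) (F l)) ->
  (forall v, (forall l, (sphere R (clique_vars c l)).@[v] = 0) ->
     0 < (\sum_l F l).@[v]) ->
  exists sigma tau : 'I_p -> {mpoly R[n.+1 + p]},
     (forall l, sos_in_vars (clique_vars c l) (sigma l)) /\
     (forall l, in_vars (clique_vars c l) (tau l)) /\
     \sum_l F l = \sum_(l < p) (sigma l + tau l * clique_sphere R c l).
Proof.
move=> rip FV F_pos.
have [G GV ->] :=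
  sparse_sphere_positivstellensatz (clique_vars_rip rip) FV F_pos.
have [sigma GV1] := fin_all_exists GV.
have [tau GV2] := fin_all_exists GV1.
exists sigma, tau; split=> [l|]; first by have [] := GV2 l.
split=> [l|]; first by have [] := GV2 l.
by apply: eq_bigr => l _; have [_ _ ->] := GV2 l; rewrite clique_sphereE.
Qed.

End Positivity.

(** * The certificates *)

Theorem theorem3p7 (R : realType) (n p d : nat) (f : {mpoly R[n]})
    (c : 'I_p -> {set 'I_n})
    (p_gt0 : (0 < p)%N)
    (deg_f : (msize f).-1 = d)
    (csp_f : admits_csp f c)
    (rip_c : running_intersection c) :
  ((forall x : 'I_n -> R, 0 <= f.@[x]) ->
   forall eps : R, 0 < eps ->
   exists sigma tau : 'I_p -> {mpoly R[n.+1 + p]},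
     (forall l, sos_in_vars (clique_vars c l) (sigma l)) /\
     (forall l, in_vars (clique_vars c l) (tau l)) /\
     homogenization p d f
       + eps *: (\sum_(i < n.+1) 'X_(ix p i) ^+ d + \sum_(l < p) 'X_(iw n l) ^+ d)
     = \sum_(l < p) (sigma l + tau l * clique_sphere R c l))
  /\
  ((forall x : 'I_n -> R, 0 < f.@[x]) ->
   positive_definite (pihomog mdeg d f) ->
   forall eps : R, 0 < eps ->
   exists sigma tau : 'I_p -> {mpoly R[n.+1 + p]},
     (forall l, sos_in_vars (clique_vars c l) (sigma l)) /\
     (forall l, in_vars (clique_vars c l) (tau l)) /\
     homogenization p d f + eps *: \sum_(l < p) 'X_(iw n l) ^+ d
     = \sum_(l < p) (sigma l + tau l * clique_sphere R c l)).
Proof.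
have [cover [g [g_c f_g]]] := csp_f.
have sz_f : (msize f <= d.+1)%N by rewrite -deg_f; case: (msize f).
have iw_V l : iw n l \in clique_vars c l by rewrite !inE eqxx orbT.
pose l0 := Ordinal p_gt0.
split.
  move=> f_ge0 eps eps0.
  have d_even : ~~ odd d by rewrite -deg_f; exact: nonneg_even_degree.
  have owner_ex (i : 'I_n.+1) : exists l, ix p i \in clique_vars c l.
    case: (unliftP ord0 i) => [j|] ->; last by exists l0; rewrite !inE eqxx.
    have : j \in \bigcup_l c l by rewrite cover inE.
    by case/bigcupP=> l _ jl; exists l; exact: ix_lift_clique_vars.
  have [owner ownerP] := fin_all_exists owner_ex.
  (* Each x_i^d has to be charged to a single clique: the one chosen by owner. *)
  pose F l := homogenization p d (g l) +
    eps *: (\sum_(i < n.+1 | owner i == l) 'X_(ix p i) ^+ d + 'X_(iw n l) ^+ d).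
  have F_V l : in_vars (clique_vars c l) (F l).
    apply: in_varsD; first exact: in_vars_homogenization.
    apply/in_varsZ/in_varsD; last exact/in_varsXn/in_varsX.
    by apply: in_vars_sum => i /eqP <-; apply/in_varsXn/in_varsX.
  have F_sum : \sum_l F l = homogenization p d f + eps *:
      (\sum_(i < n.+1) 'X_(ix p i) ^+ d + \sum_(l < p) 'X_(iw n l) ^+ d).
    rewrite big_split /= -homogenization_sum -f_g -scaler_sumr big_split /=.
    by rewrite [X in _ = _ + _ *: (X + _)](partition_big owner xpredT).
  rewrite -F_sum; apply: sparse_certificate => // v v_sphere.
  rewrite F_sum mevalD mevalZ; apply: ltr_wpDl.
    exact: homogenization_ge0.
  apply: mulr_gt0 => //; rewrite mevalD !rmorph_sum /=.
  have pow_ge0 j : 0 <= ('X_j ^+ d).@[v] by rewrite rmorphXn exprn_even_ge0.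
  have [j j_V vj] := sphere_point_nonzero (v_sphere l0).
  have pow_gt0 : 0 < ('X_j ^+ d).@[v].
    by rewrite rmorphXn /= mevalXU exprn_even_gt0 // vj orbT.
  case: (split_ordP j) => k ej; rewrite ej in pow_gt0.
    apply: ltr_pwDl; last exact: sumr_ge0.
    by rewrite (bigD1 k) //=; apply: ltr_pwDl => //; exact: sumr_ge0.
  apply: ltr_wpDl; first exact: sumr_ge0.
  by rewrite (bigD1 k) //=; apply: ltr_pwDl => //; exact: sumr_ge0.
move=> f_gt0 top_gt0 eps eps0.
have f_ge0 x : 0 <= f.@[x] by exact: ltW.
have d_even : ~~ odd d by rewrite -deg_f; exact: nonneg_even_degree.
pose F l := homogenization p d (g l) + eps *: 'X_(iw n l) ^+ d.
have F_V l : in_vars (clique_vars c l) (F l).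
  apply: in_varsD; first exact: in_vars_homogenization.
  exact/in_varsZ/in_varsXn/in_varsX.
have F_sum : \sum_l F l =
    homogenization p d f + eps *: \sum_(l < p) 'X_(iw n l) ^+ d.
  by rewrite big_split /= -homogenization_sum -f_g -scaler_sumr.
rewrite -F_sum; apply: sparse_certificate => // v v_sphere.
rewrite F_sum mevalD mevalZ [X in _ + _ * X]rmorph_sum /=.
have pow_ge0 j : 0 <= ('X_j ^+ d).@[v] by rewrite rmorphXn exprn_even_ge0.
have w_ge0 : 0 <= eps * \sum_(l < p) ('X_(iw n l) ^+ d).@[v].
  by apply: mulr_ge0; [exact: ltW|exact: sumr_ge0].
(* The homogenization is positive except where x_0 and all x_i vanish, and there
   every w_l is nonzero. *)
have [v0|v0] := eqVneq (v (ix p ord0)) 0; last first.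
  apply: ltr_pwDl => //; rewrite homogenizationE // mulr_gt0 //.
  by rewrite exprn_even_gt0 // v0 orbT.
have [/existsP vx|/existsPn vx] :=
    boolP [exists i, v (ix p (lift ord0 i)) != 0].
  apply: ltr_pwDl => //; rewrite homogenization_at_infinity //.
  exact: top_gt0.
apply: ltr_wpDl; first exact: homogenization_ge0.
apply: mulr_gt0 => //.
have [j j_V vj] := sphere_point_nonzero (v_sphere l0).
move: j_V vj; rewrite !inE -orbA => /or3P[/eqP ->|/eqP ej|/imsetP[i _ ->]].
- by rewrite v0 eqxx.
- rewrite ej => vj; rewrite (bigD1 l0) //=.
  apply: ltr_pwDl; last exact: sumr_ge0.
  by rewrite rmorphXn /= mevalXU exprn_even_gt0 // vj orbT.
- by move=> vi; have := vx i; rewrite vi.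
Qed.
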